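(* The Waterfall algorithm runs in $\mathcal{O}(m\,n^3)$ time for any $m\times n$ matching matrix $\mathbf M$ and oracle prediction.
   Context: $N=[n]$ is a set of agents, $i$ an additional target agent, $G_i\subseteq N$ its (unknown) influencer set. A labelling is $\ell:N\to\{\phi,\neg\phi\}$, where $\ell(j)=\phi$ means $j$ agrees with $i$ and $\ell(j)=\neg\phi$ that $j$ disagrees with $i$. The majority protocol $f^+(\ell,F)$ is the boolean sentence $\sum_{j\in F}(\mathbf 1(\ell(j)\neq\phi)-\mathbf 1(\ell(j)=\phi))>0$ (True iff $i$ with influencers $F$ changes opinion). For a sample $\ell_1,\dots,\ell_m$ with oracle predictions $f^+(\ell_k,G_i)$, the matching set $M(\ell_k)\subseteq N$ is $\{j:\ell_k(j)=\neg\phi\}$ if $f^+(\ell_k,G_i)$ is True and $\{j:\ell_k(j)=\phi\}$ if it is False. The matching transformation (matching matrix) is the $m\times n$ matrix $\mathbf M$ with $\mathbf M_{k,j}=1$ if $j\in M(\ell_k)$ and $-1$ otherwise. A set $F\subseteq N$ is a feasible influencer set if $f^+(\ell_k,F)=f^+(\ell_k,G_i)$ for all $k$; equivalently all sums $D_k(F)=\sum_{j\in F}\mathbf M_{k,j}$ are $\ge 0$, and $D_k(F)=0$ only if $f^+(\ell_k,G_i)$ is False. Row states for a set $F$: row $k$ is inconsistent (I) if $D_k(F)<0$; inconsistent tie (IT) if $D_k(F)=0$ and $f^+(\ell_k,G_i)$ is True; consistent tie (CT) if $D_k(F)=0$ and $f^+(\ell_k,G_i)$ is False; barely consistent (BC)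 if $D_k(F)=1$ and $f^+(\ell_k,G_i)$ is True; consistent otherwise. Waterfall algorithm. Input: $\mathbf M$ and the oracle predictions $f^+(\ell_k,G_i)$, $k=1,\dots,m$. 1. If $\emptyset$ is feasible, return $\emptyset$. 2. For each $s\in N$: set $F=\{s\}$. While $F\neq N$: compute the states of all rows for $F$; if some row is in state I or IT, let $R$ be the set of rows in state I, IT, CT or BC, choose (ties broken arbitrarily) an agent $j\in\operatorname{argmax}_{j\in N\setminus F}\sum_{r\in R}\mathbf 1(j\in M(\ell_r))$ and add $j$ to $F$; otherwise return $F$. 3. If $N$ is feasible, return $N$; otherwise report that no solution was found. *)

(* Defs.v *)
From mathcomp Require Import all_boot all_order all_algebra.

Set Implicit Arguments.
Unset Strict Implicit.
Unset Printing Implicit Defensive.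

Import Order.TTheory GRing.Theory Num.Theory.
Local Open Scope ring_scope.

(* The file has two parts: the Waterfall algorithm as a
   nondeterministic procedure on sets of agents, and its implementation as a
   program of a unit-cost random access machine, whose instruction count is the
   running time. *)

(* [l j = true] encodes l(j) = phi (agent j agrees with the target agent);
   [l j = false] encodes l(j) = not phi. *)
Definition labelling (n : nat) := 'I_n -> bool.

Definition fplus n (l : labelling n) (F : {set 'I_n}) : bool :=
  0 < \sum_(j in F) ((l j == false)%:R - (l j == true)%:R : int).

Definition oracle m n (L : 'I_m -> labelling n) (G : {set 'I_n}) (k : 'I_m) :
  bool := fplus (L k) G.

Definition matching_set n (l : labelling n) (G : {set 'I_n}) : {set 'I_n} :=
  if fplus l G then [set j | l j == false] else [set j | l j == true].

Definition matching_mx m n (L : 'I_m -> labelling n) (G : {set 'I_n}) :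
  'M[int]_(m, n) :=
  \matrix_(k, j) if j \in matching_set (L k) G then 1 else -1.

Definition feasible m n (L : 'I_m -> labelling n) (G F : {set 'I_n}) : bool :=
  [forall k, fplus (L k) F == fplus (L k) G].

Definition rowsum m n (M : 'M[int]_(m, n)) (F : {set 'I_n}) (k : 'I_m) : int :=
  \sum_(j in F) M k j.

Inductive row_state :=
  | Inconsistent | InconsistentTie | ConsistentTie | BarelyConsistent
  | Consistent.

Definition state_of m n (M : 'M[int]_(m, n)) (y : 'I_m -> bool)
    (F : {set 'I_n}) (k : 'I_m) : row_state :=
  let D := rowsum M F k in
  if D < 0 then Inconsistent
  else if D == 0 then (if y k then InconsistentTie else ConsistentTie)
  else if (D == 1) && y k then BarelyConsistent
  else Consistent.

Definition violated (st : row_state) : bool :=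
  match st with Inconsistent | InconsistentTie => true | _ => false end.

Definition critical (st : row_state) : bool :=
  match st with Consistent => false | _ => true end.

Section Waterfall.
Variables (m n : nat) (L : 'I_m -> labelling n) (G : {set 'I_n}).

Let row F k := state_of (matching_mx L G) (oracle L G) F k.

Definition has_violation (F : {set 'I_n}) : bool :=
  [exists k, violated (row F k)].

Definition score (F : {set 'I_n}) (j : 'I_n) : nat :=
  \sum_(r < m | critical (row F r)) (j \in matching_set (L r) G).

Definition is_argmax (F : {set 'I_n}) (j : 'I_n) : bool :=
  (j \notin F) && [forall i, (i \notin F) ==> (score F i <= score F j)%N].

(* [grow F out]: the while loop entered with the set F may end with [out];
   [Some F'] means that F' is returned, [None] that the loop ends with F = N
   without returning. *)
Inductive grow : {set 'I_n} -> option {set 'I_n} -> Prop :=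
  | grow_full : grow setT None
  | grow_return F : F != setT -> ~~ has_violation F -> grow F (Some F)
  | grow_add F j out :
      F != setT -> has_violation F -> is_argmax F j ->
      grow (j |: F) out -> grow F out.

Inductive try_seeds : seq 'I_n -> option {set 'I_n} -> Prop :=
  | seeds_nil : try_seeds [::] None
  | seeds_return s ss F :
      grow [set s] (Some F) -> try_seeds (s :: ss) (Some F)
  | seeds_next s ss out :
      grow [set s] None -> try_seeds ss out -> try_seeds (s :: ss) out.

(* [waterfall out]: for some way of breaking the ties, the algorithm returns
   the set F if [out = Some F], and reports that no solution was found if
   [out = None]. *)
Inductive waterfall : option {set 'I_n} -> Prop :=
  | waterfall_empty : feasible L G set0 -> waterfall (Some set0)
  | waterfall_seed F :
      ~~ feasible L G set0 -> try_seeds (enum 'I_n) (Some F) ->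
      waterfall (Some F)
  | waterfall_all :
      ~~ feasible L G set0 -> try_seeds (enum 'I_n) None ->
      feasible L G setT -> waterfall (Some setT)
  | waterfall_fail :
      ~~ feasible L G set0 -> try_seeds (enum 'I_n) None ->
      ~~ feasible L G setT -> waterfall None.

End Waterfall.

Inductive var :=
  | Vm | Vn            (* dimensions of the matrix *)
  | Vj | Vk | Vs       (* current agent, row, seed *)
  | Vd                 (* row sum *)
  | Vviol              (* is some row inconsistent or an inconsistent tie? *)
  | Vcnt | Vbest | Varg  (* argmax computation *)
  | Vcoin | Vsize | Vfound.

(* AM: the matrix, in row-major order; AY: the predictions; AF: the
   characteristic vector of F; AS: the states of the rows. *)
Inductive arr := AM | AY | AF | AS.

Scheme Equality for var.
Scheme Equality for arr.

Inductive binop := Add | Mul | Eq | Lt | And.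

Inductive expr :=
  | Cst of int
  | Var of var
  | Get of arr & expr
  | Bin of binop & expr & expr.

Inductive stmt :=
  | Assign of var & expr
  | Store of arr & expr & expr
  | Flip of var          (* nondeterministic bit, used for breaking ties *)
  | Skip
  | Seq of stmt & stmt
  | If of expr & stmt & stmt
  | While of expr & stmt.

(* [coins i] is the outcome of the i-th Flip instruction to come; quantifying
   over all coin sequences amounts to quantifying over all tie-breakings. *)
Record state := State {
  vars : var -> int;
  arrs : arr -> nat -> int;
  coins : nat -> bool }.

Definition set_var (s : state) (x : var) (v : int) : state :=
  State (fun z => if var_eq_dec z x then v else vars s z) (arrs s) (coins s).

Definition set_arr (s : state) (a : arr) (p : nat) (v : int) : state :=
  State (vars s)
    (fun b q => if arr_eq_dec b a then if q == p then v else arrs s b q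
                else arrs s b q)
    (coins s).

Definition flip_var (s : state) (x : var) : state :=
  set_var (State (vars s) (arrs s) (fun i => coins s i.+1)) x
          (coins s 0%N)%:R.

Definition eval_binop (o : binop) (x y : int) : int :=
  match o with
  | Add => x + y
  | Mul => x * y
  | Eq => (x == y)%:R
  | Lt => (x < y)%R%:R
  | And => ((x != 0) && (y != 0))%R%:R
  end.

(* Addresses are natural numbers: an index is read through its absolute
   value. *)
Fixpoint eval (s : state) (e : expr) : int :=
  match e with
  | Cst c => c
  | Var x => vars s x
  | Get a e => arrs s a `|eval s e|%N
  | Bin o e1 e2 => eval_binop o (eval s e1) (eval s e2)
  end.

(* One time unit per constant, register access, memory access and arithmetic
   or logical operation.  Unit cost is realistic here: the Waterfall program
   only computes integers of absolute value at most max(m * n, 4). *)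
Fixpoint cost (e : expr) : nat :=
  match e with
  | Cst _ | Var _ => 1
  | Get _ e => (cost e).+1
  | Bin _ e1 e2 => (cost e1 + cost e2).+1
  end.

(* [exec c s t s']: started in s, the program c stops in s' after t time
   units. *)
Inductive exec : stmt -> state -> nat -> state -> Prop :=
  | exec_assign x e s :
      exec (Assign x e) s (cost e).+1 (set_var s x (eval s e))
  | exec_store a i e s :
      exec (Store a i e) s (cost i + cost e).+1
           (set_arr s a `|eval s i|%N (eval s e))
  | exec_flip x s : exec (Flip x) s 1 (flip_var s x)
  | exec_skip s : exec Skip s 1 s
  | exec_seq c1 c2 s s1 s2 t1 t2 :
      exec c1 s t1 s1 -> exec c2 s1 t2 s2 -> exec (Seq c1 c2) s (t1 + t2).+1 s2
  | exec_if_true e c1 c2 s s1 t :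
      eval s e != 0 -> exec c1 s t s1 -> exec (If e c1 c2) s (cost e + t).+1 s1
  | exec_if_false e c1 c2 s s1 t :
      eval s e = 0 -> exec c2 s t s1 -> exec (If e c1 c2) s (cost e + t).+1 s1
  | exec_while_false e c s : eval s e = 0 -> exec (While e c) s (cost e).+1 s
  | exec_while_true e c s s1 s2 t1 t2 :
      eval s e != 0 -> exec c s t1 s1 -> exec (While e c) s1 t2 s2 ->
      exec (While e c) s (cost e + t1 + t2).+1 s2.

(* The coins being part of the state, the run is unique. *)
Lemma exec_det c s t1 s1 t2 s2 :
  exec c s t1 s1 -> exec c s t2 s2 -> t1 = t2 /\ s1 = s2.
Proof.
move=> E1; elim: E1 t2 s2 => {c s t1 s1}
  [x e s|a i e s|x s|s|c1 c2 s s1 s2 t1 t2 _ IH1 _ IH2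
  |e c1 c2 s s1 t He _ IH|e c1 c2 s s1 t He _ IH|e c s He
  |e c s s1 s2 t1 t2 He _ IH1 _ IH2] u r E;
  inversion E; subst => //;
  repeat match goal with
  | H : eval ?s ?e = 0, H' : is_true (eval ?s ?e != 0) |- _ =>
      by rewrite H eqxx in H'
  | IH : forall t' s', exec ?c ?s t' s' -> _, H : exec ?c ?s ?t' ?s' |- _ =>
      let Et := fresh in let Es := fresh in
      case: (IH _ _ H) => Et Es; clear IH H; subst
  end => //.
Qed.

Declare Scope expr_scope.
Delimit Scope expr_scope with expr.
Bind Scope expr_scope with expr.
Declare Scope stmt_scope.
Delimit Scope stmt_scope with stmt.
Bind Scope stmt_scope with stmt.

Coercion Var : var >-> expr.
Notation "a .[ e ]" := (Get a e%expr) : expr_scope.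
Notation "x + y" := (Bin Add x%expr y%expr) : expr_scope.
Notation "x * y" := (Bin Mul x%expr y%expr) : expr_scope.
Notation "x =? y" := (Bin Eq x%expr y%expr) (at level 70) : expr_scope.
Notation "x <? y" := (Bin Lt x%expr y%expr) (at level 70) : expr_scope.
Notation "x && y" := (Bin And x%expr y%expr) : expr_scope.
Notation "x ::= e" := (Assign x e%expr) (at level 75) : stmt_scope.
Notation "c1 ;; c2" := (Seq c1%stmt c2%stmt)
  (at level 85, right associativity) : stmt_scope.

(* for x = 0, ..., e - 1 do c *)
Definition For (x : var) (e : expr) (c : stmt) : stmt :=
  (x ::= Cst 0 ;; While (x <? e) (c ;; x ::= x + Cst 1))%stmt.

(* Encoding of the row states in AS. *)
Definition code (st : row_state) : int :=
  match st with
  | Consistent => 0 | BarelyConsistent => 1 | ConsistentTie => 2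
  | InconsistentTie => 3 | Inconsistent => 4
  end.

Definition set_state (st : row_state) : stmt := (Store AS Vk (Cst (code st))).

(* F is feasible iff this block leaves 0 in Vviol, so it also performs the
   feasibility tests for the empty set and for N. *)
Definition compute_states : stmt :=
  (Vviol ::= Cst 0 ;;
   For Vk Vm
     (Vd ::= Cst 0 ;;
      For Vj Vn
        (If AF.[Vj] (Vd ::= Vd + AM.[Vk * Vn + Vj]) Skip) ;;
      If (Vd <? Cst 0)
        (set_state Inconsistent ;; Vviol ::= Cst 1)
        (If (Vd =? Cst 0)
           (If AY.[Vk]
              (set_state InconsistentTie ;; Vviol ::= Cst 1)
              (set_state ConsistentTie))
           (If ((Vd =? Cst 1) && AY.[Vk])
              (set_state BarelyConsistent)
              (set_state Consistent)))))%stmt.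

(* Each agent outside F whose score equals the best one so far replaces the
   current candidate or not according to a coin, so that every maximizer can
   end up in Varg. *)
Definition add_agent : stmt :=
  (Vbest ::= Cst (-1) ;;
   For Vj Vn
     (If AF.[Vj] Skip
        (Vcnt ::= Cst 0 ;;
         For Vk Vm
           (If (AS.[Vk] =? Cst (code Consistent)) Skip
              (If (AM.[Vk * Vn + Vj] =? Cst 1)
                 (Vcnt ::= Vcnt + Cst 1) Skip)) ;;
         If (Vbest <? Vcnt)
           (Vbest ::= Vcnt ;; Varg ::= Vj)
           (If (Vbest =? Vcnt)
              (Flip Vcoin ;; If Vcoin (Varg ::= Vj) Skip)
              Skip))) ;;
   Store AF Varg (Cst 1) ;;
   Vsize ::= Vsize + Cst 1)%stmt.

(* Returning F is Vfound ::= 1, after which every loop is left. *)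
Definition waterfall_prog : stmt :=
  (Vfound ::= Cst 0 ;;
   For Vj Vn (Store AF Vj (Cst 0)) ;;
   compute_states ;;
   If (Vviol =? Cst 0) (Vfound ::= Cst 1)
     (Vs ::= Cst 0 ;;
      While ((Vs <? Vn) && (Vfound =? Cst 0))
        (For Vj Vn (Store AF Vj (Cst 0)) ;;
         Store AF Vs (Cst 1) ;;
         Vsize ::= Cst 1 ;;
         While ((Vsize <? Vn) && (Vfound =? Cst 0))
           (compute_states ;;
            If (Vviol =? Cst 0) (Vfound ::= Cst 1) add_agent) ;;
         Vs ::= Vs + Cst 1) ;;
      If (Vfound =? Cst 0)
        (For Vj Vn (Store AF Vj (Cst 1)) ;;
         compute_states ;;
         If (Vviol =? Cst 0) (Vfound ::= Cst 1) Skip)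
        Skip))%stmt.

(* The registers and arrays other than the input, and the cells outside the
   input arrays, may hold anything. *)
Definition holds_input m n (M : 'M[int]_(m, n)) (y : 'I_m -> bool)
    (s : state) : Prop :=
  [/\ vars s Vm = m, vars s Vn = n,
      forall (k : 'I_m) (j : 'I_n), arrs s AM (k * n + j)%N = M k j
    & forall k : 'I_m, arrs s AY k = (y k)%:R].

Definition output n (s : state) : option {set 'I_n} :=
  if vars s Vfound == 1 then Some [set j : 'I_n | arrs s AF j != 0] else None.

(* Main.v *)
Require Import Defs.
From mathcomp Require Import all_boot all_order all_algebra.
From mathcomp Require Import zify.

Set Implicit Arguments.
Unset Strict Implicit.
Unset Printing Implicit Defensive.

Import Order.TTheory GRing.Theory Num.Theory.

(* Computing the row states scans the matrix once, and so does the choice of a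
   score-maximizing agent, hence one round of the inner loop costs O(mn).  Each
   round enlarges F, so a seed needs fewer than n rounds and costs O(mn^2); there
   are n seeds.  The initial and final feasibility tests cost O(mn) each. *)

(** * Time-bounded total correctness triples and frame conditions *)

Definition runs c s T (Q : state -> Prop) : Prop :=
  exists t s', [/\ exec c s t s', Q s' & t <= T].

Fixpoint writes_var (c : stmt) (x : var) : bool :=
  match c with
  | Assign y _ | Flip y => var_beq x y
  | Store _ _ _ | Skip => false
  | Seq c1 c2 | If _ c1 c2 => writes_var c1 x || writes_var c2 x
  | While _ c => writes_var c x
  end.

Fixpoint writes_arr (c : stmt) (a : arr) : bool :=
  match c with
  | Store b _ _ => arr_beq a b
  | Assign _ _ | Flip _ | Skip => false
  | Seq c1 c2 | If _ c1 c2 => writes_arr c1 a || writes_arr c2 a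
  | While _ c => writes_arr c a
  end.

(** A syntactic over-approximation of the effect of a program: whatever it has no instruction to
    write is preserved. Loop invariants then need to mention only the data that the loop changes. *)
Definition frame (c : stmt) (s s' : state) : Prop :=
  (forall x, ~~ writes_var c x -> vars s' x = vars s x) /\
  (forall a, ~~ writes_arr c a -> arrs s' a =1 arrs s a).

Lemma exec_frame c s t s' : exec c s t s' -> frame c s s'.
Proof.
elim=> {c s t s'} //=.
- move=> x e s; split=> //= z.
  case: var_eq_dec => /= [->|//]; by rewrite (internal_var_dec_lb (erefl x)).
- move=> a i e s; split=> //= b.
  case: arr_eq_dec => /= [->|//]; by rewrite (internal_arr_dec_lb (erefl a)).
- move=> x s; split=> //= z.
  case: var_eq_dec => /= [->|//]; by rewrite (internal_var_dec_lb (erefl x)).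
- move=> c1 c2 s s1 s2 t1 t2 _ [v1 a1] _ [v2 a2].
  split=> [x|a] /=; rewrite negb_or => /andP[h1 h2].
    by rewrite v2 // v1.
  by move=> q; rewrite a2 // a1.
- move=> e c1 c2 s s1 t _ _ [v1 a1].
  by split=> [x|a] /=; rewrite negb_or => /andP[h1 h2]; [exact: v1|exact: a1].
- move=> e c1 c2 s s1 t _ _ [v1 a1].
  by split=> [x|a] /=; rewrite negb_or => /andP[h1 h2]; [exact: v1|exact: a1].
- move=> e c s s1 s2 t1 t2 _ _ [v1 a1] _ [v2 a2].
  split=> [x|a] /= h; first by rewrite v2 // v1.
  by move=> q; rewrite a2 // a1.
Qed.

Lemma runs_frame c s T Q :
  runs c s T Q -> runs c s T (fun s' => frame c s s' /\ Q s').
Proof.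
case=> t [s' [E q le]]; exists t, s'; split=> //; split=> //.
exact: exec_frame E.
Qed.

Lemma runs_weaken c s T T' (Q Q' : state -> Prop) :
  runs c s T Q -> (forall s', Q s' -> Q' s') -> T <= T' -> runs c s T' Q'.
Proof.
by case=> t [s' [E q le]] QQ' TT'; exists t, s'; split; [|exact: QQ'|exact: leq_trans TT'].
Qed.

(** The triple for [c2] is the postcondition of the triple for [c1], so a program is traversed from
    left to right with a decreasing budget. The strict inequality pays the unit charged for
    sequencing. *)
Lemma runs_seq c1 c2 s T1 T2 T Q :
  runs c1 s T1 (fun s1 => runs c2 s1 T2 Q) -> T1 + T2 < T -> runs (Seq c1 c2) s T Q.
Proof.
case=> t1 [s1 [E1 [t2 [s2 [E2 q le2]]] le1]] le.
by exists (t1 + t2).+1, s2; split=> //; [exact: exec_seq E1 E2|lia].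
Qed.

(** * Symbolic evaluation of loop-free code, and rules for branching and loops *)

Fixpoint loop_free (c : stmt) : bool :=
  match c with
  | While _ _ => false
  | Seq c1 c2 | If _ c1 c2 => loop_free c1 && loop_free c2
  | _ => true
  end.

(** The value on [While] is a dummy, excluded by [loop_free] wherever [run] is used to describe an
    execution. *)
Fixpoint run (c : stmt) (s : state) : state :=
  match c with
  | Assign x e => set_var s x (eval s e)
  | Store a i e => set_arr s a `|eval s i|%N (eval s e)
  | Flip x => flip_var s x
  | Skip | While _ _ => s
  | Seq c1 c2 => run c2 (run c1 s)
  | If e c1 c2 => if eval s e == 0 then run c2 s else run c1 s
  end.

Fixpoint run_time (c : stmt) : nat :=
  match c with
  | Assign x e => (cost e).+1
  | Store a i e => (cost i + cost e).+1
  | Flip _ | Skip | While _ _ => 1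
  | Seq c1 c2 => (run_time c1 + run_time c2).+1
  | If e c1 c2 => (cost e + maxn (run_time c1) (run_time c2)).+1
  end.

(** Turns a loop-free block into a computation: simplification yields the final state and a bound on
    the time that does not depend on the state, the dearer branch being charged at each test. *)
Lemma runs_loop_free c s T (Q : state -> Prop) :
  loop_free c -> Q (run c s) -> run_time c <= T -> runs c s T Q.
Proof.
move=> lf q le; suff [t E le_t] : exists2 t, exec c s t (run c s) & t <= run_time c.
  by exists t, (run c s); split=> //; exact: leq_trans le.
elim: c s lf {q le} => //=.
- by move=> x e s _; eexists; [exact: exec_assign|].
- by move=> a i e s _; eexists; [exact: exec_store|].
- by move=> x s _; eexists; [exact: exec_flip|].
- by move=> s _; eexists; [exact: exec_skip|].
- move=> c1 IH1 c2 IH2 s /andP[/IH1 {}IH1 /IH2 {}IH2].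
  have [t1 E1 l1] := IH1 s; have [t2 E2 l2] := IH2 (run c1 s).
  by eexists; [exact: exec_seq E1 E2|lia].
- move=> e c1 IH1 c2 IH2 s /andP[/IH1 {}IH1 /IH2 {}IH2].
  have [t1 E1 l1] := IH1 s; have [t2 E2 l2] := IH2 s.
  by case: eqP => [e0|/eqP e0]; eexists;
    [exact: exec_if_false e0 E2|lia|exact: exec_if_true e0 E1|lia].
Qed.

Lemma runs_if e c1 c2 s T1 T Q :
  runs (if eval s e == 0%R then c2 else c1) s T1 Q -> cost e + T1 < T ->
  runs (If e c1 c2) s T Q.
Proof.
case: eqP => [e0|/eqP e0] [t [s' [E q le]]] leT; eexists; exists s'; split.
- exact: exec_if_false e0 E.
- exact: q.
- lia.
- exact: exec_if_true e0 E.
- exact: q.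
- lia.
Qed.

Lemma runs_while_stop e c s T (Q : state -> Prop) :
  eval s e = 0%R -> Q s -> cost e < T -> runs (While e c) s T Q.
Proof. by move=> e0 q le; exists (cost e).+1, s; split=> //; exact: exec_while_false. Qed.

Lemma runs_while_step e c s T1 T2 T Q :
  eval s e != 0%R -> runs c s T1 (fun s1 => runs (While e c) s1 T2 Q) ->
  cost e + T1 + T2 < T -> runs (While e c) s T Q.
Proof.
move=> e0 [t1 [s1 [E1 [t2 [s2 [E2 q le2]]] le1]]] le.
by exists (cost e + t1 + t2).+1, s2; split=> //; [exact: exec_while_true E1 E2|lia].
Qed.

(** * Counting loops *)

Section Execution.
Local Open Scope ring_scope.

(* Each round adds 3 units for the test, 4 for the increment and 2 for
   sequencing; the initialization and the final test take 7. *)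
Lemma runs_for (x y : var) c (N B : nat) (I : nat -> state -> Prop) s :
  ~~ writes_var c x -> ~~ writes_var (For x y c) y -> vars s y = N ->
  (forall i s' v, I i s' -> I i (set_var s' x v)) ->
  I 0%N s ->
  (forall i s', (i < N)%N -> frame (For x y c) s s' -> vars s' x = i ->
     I i s' -> runs c s' B (I i.+1)) ->
  runs (For x y c) s (N * (B + 9) + 7)
    (fun s' => frame (For x y c) s s' /\ I N s').
Proof.
move=> cx cy sy Ix I0 Istep; apply: runs_frame.
apply: (@runs_seq _ _ _ 2 (N * (B + 9) + 4)); last lia.
apply: runs_loop_free => //=.
have fr_trans s1 s2 s3 : frame (For x y c) s1 s2 ->
    frame (For x y c) s2 s3 -> frame (For x y c) s1 s3.
  move=> [v1 a1] [v2 a2]; split=> [z h|a h q]; first by rewrite v2 // v1.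
  by rewrite a2 // a1.
have set_x s' v : frame (For x y c) s' (set_var s' x v).
  split=> //= z; case: var_eq_dec => /= [->|//].
  by rewrite (internal_var_dec_lb (erefl x)).
have frc s1 s2 : frame c s1 s2 -> frame (For x y c) s1 s2.
  move=> [v a]; split=> [z|b] /=; rewrite ?orbF; last by move/a.
  by rewrite !negb_or => /and3P[_ /v].
(* Induction on the number [d] of remaining iterations. The frame relation to the entry state is
   carried along because it keeps the bound [y] equal to [N]; [Ix] carries the invariant over the
   increment of the counter. *)
suff loop d : forall i s', (d + i)%N = N -> frame (For x y c) s s' ->
    vars s' x = i -> I i s' ->
    runs (While (Bin Lt x y) (Seq c (Assign x (Bin Add x (Cst 1))))) s'
      (d * (B + 9) + 4) (I N).
  apply: (loop N 0%N); rewrite ?addn0 //=; last exact: Ix.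
  by case: var_eq_dec.
elim: d => [|d IHd] i s' di fr s'x Ii.
  apply: runs_while_stop => //=; last by rewrite -di.
  by rewrite s'x fr.1 // sy -di add0n ltxx.
apply: (@runs_while_step _ _ _ (B + 5) (d * (B + 9) + 4)) => //=; last lia.
  by rewrite s'x fr.1 // sy ltz_nat; have -> : (i < N)%N by lia.
apply: (@runs_seq _ _ _ B 4) => //=; last lia.
have iN : (i < N)%N by lia.
apply: runs_weaken (runs_frame (Istep i s' iN fr s'x Ii)) _ (leqnn _).
move=> s1 [fr1 I1]; apply: runs_loop_free => //=.
apply: (IHd i.+1); first lia.
- by apply: (fr_trans _ _ _ fr); apply: (fr_trans _ _ _ _ (set_x _ _)); exact: frc.
- by rewrite /= fr1.1 // s'x; case: var_eq_dec => /= [_|//]; rewrite -addn1 PoszD.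
- exact: Ix.
Qed.


(** * Row states, choice of the next agent, and feasibility *)

Lemma sum_ltS n (f : 'I_n -> int) (k : 'I_n) :
  \sum_(r < n | (r < k.+1)%N) f r = \sum_(r < n | (r < k)%N) f r + f k.
Proof.
rewrite (bigD1 k) //= addrC; congr (_ + _); apply: eq_bigl => r.
by rewrite ltnS -val_eqE /=; lia.
Qed.

Lemma exists_ltS n (p : pred 'I_n) (k : 'I_n) :
  [exists r : 'I_n, (r < k.+1)%N && p r] = [exists r : 'I_n, (r < k)%N && p r] || p k.
Proof.
apply/existsP/orP => [[r /andP[]]|[/existsP[r /andP[rk pr]]|pk]].
- rewrite ltnS leq_eqVlt => /orP[/eqP/val_inj -> pk|rk pr]; first by right.
  by left; apply/existsP; exists r; rewrite rk.
- by exists r; rewrite ltnS ltnW.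
- by exists k; rewrite ltnSn.
Qed.

Section Waterfall_run.
Variables (m n : nat) (L : 'I_m -> labelling n) (G : {set 'I_n}).
Hypotheses (m_gt0 : (0 < m)%N) (n_gt0 : (0 < n)%N).
Let M := matching_mx L G.
Let y := oracle L G.

Definition represents (s : state) (F : {set 'I_n}) : Prop :=
  forall j : 'I_n, arrs s AF j = (j \in F)%:R.

Lemma holds_input_frame c s s' :
  ~~ [|| writes_var c Vm, writes_var c Vn, writes_arr c AM | writes_arr c AY] ->
  frame c s s' -> holds_input M y s -> holds_input M y s'.
Proof.
rewrite !negb_or => /and4P[cm cn cM cY] [fv fa] [sm sn sM sY].
by split=> [| |k j|k]; rewrite ?fv ?fa.
Qed.

Lemma represents_frame c s s' F :
  ~~ writes_arr c AF -> frame c s s' -> represents s F -> represents s' F.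
Proof. by move=> cF [_ fa] sF j; rewrite fa. Qed.

Definition states_ready (s : state) (F : {set 'I_n}) : Prop :=
  forall k : 'I_m, arrs s AS k = code (state_of M y F k).

Lemma runs_compute_states s F : holds_input M y s -> represents s F ->
  runs compute_states s (150 * (m * n)) (fun s' =>
    [/\ frame compute_states s s', vars s' Vviol = (has_violation L G F)%:R
      & states_ready s' F]).
Proof.
move=> inp sF; have [sm sn sM sY] := inp.
(* Invariant of the loop over rows: the flag and the stored codes are right for the rows already
   visited. *)
pose I k s' := vars s' Vviol =
    [exists r : 'I_m, (r < k)%N && violated (state_of M y F r)]%:R /\
  forall r : 'I_m, (r < k)%N -> arrs s' AS r = code (state_of M y F r).
suff H : runs compute_states s (150 * (m * n)) (I m).
  have H2 := runs_frame H; apply: (runs_weaken H2) (leqnn _) => s' [fr [s'v s'S]].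
  split=> // [|k]; last by rewrite s'S.
  by rewrite s'v; congr (nat_of_bool _)%:R; apply: eq_existsb => r; rewrite ltn_ord.
(* Each row is allotted [101 * n], to which the loop rule adds 9. As [m] and [n] are positive, the
   lower-order terms fit into [150 * (m * n)]. *)
apply: (@runs_seq _ _ _ 2 (m * (101 * n + 9) + 7)); last nia.
apply: runs_loop_free => //=.
set s0 := set_var _ _ _.
apply: (runs_weaken (@runs_for Vk Vm _ m (101 * n) I s0 _ _ _ _ _ _) _ (leqnn _)) => //=.
- by split=> //=; rewrite (_ : [exists _, _] = false) //; apply/existsP; case.
- move=> k s1 km fr s1k [s1v s1S].
  pose k' := Ordinal km; have kE : k = k' by [].
  have {}inp : holds_input M y s1.
    by apply: (holds_input_frame _ fr) => //; case: inp.
  have {}sF : represents s1 F by exact: (represents_frame _ fr).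
  case: inp => {}sm {}sn {}sM {}sY.
  apply: (@runs_seq _ _ _ 2 (21 * n + 71)) => //=; last lia.
  apply: runs_loop_free => //=.
  set s2 := set_var _ _ _.
  (* 12 is the worst-case cost of adding one matrix entry to the row sum; 60 bounds the
     classification of the row. *)
  apply: (@runs_seq _ _ _ (n * (12 + 9) + 7) 60); last lia.
  pose J i s' := vars s' Vd = \sum_(j < n | (j < i)%N) (if j \in F then M k' j else 0).
  apply: (runs_weaken (@runs_for Vj Vn _ n 12 J s2 _ _ _ _ _ _) _ (leqnn _)) => //=.
  + by rewrite /J big_pred0.
  + move=> j s3 jn fr3 s3j Jj; pose j' := Ordinal jn; have jE : j = j' by [].
    apply: runs_loop_free => //=.
    rewrite s3j (fr3.1 Vk) //= (fr3.1 Vn) //= (fr3.2 AM) //= (fr3.2 AF) //=.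
    rewrite s1k sn -PoszM -PoszD !absz_nat.
    rewrite (sM k' j') (sF j').
    rewrite /J jE sum_ltS.
    by case: (j' \in F) => /=; rewrite Jj ?addr0.
  + move=> s3 [fr3]; rewrite /J => Jn.
    have dE : vars s3 Vd = rowsum M F k'.
      by rewrite Jn /rowsum big_mkcond [RHS]big_mkcond; apply: eq_bigr => j _; rewrite ltn_ord.
    apply: runs_loop_free => //=.
    rewrite dE (fr3.1 Vk) //= (fr3.2 AY) //= s1k kE sY absz_nat.
    pose st := state_of M y F k'; pose s4 := set_arr s3 AS k' (code st).
    (* All branches of the classification have one shape: store the code of the row state, and raise
       the flag exactly when that state is violated. *)
    rewrite (_ : (if _ then _ else _) =
                 if violated st then set_var s4 Vviol 1 else s4); last first.
      rewrite /s4 /st /state_of.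
      by case: (rowsum M F k' < 0); case: (rowsum M F k' == 0); case: (rowsum M F k' == 1); case: (y k').
    rewrite /I exists_ltS -/st.
    have viol3 : vars s3 Vviol = vars s1 Vviol by rewrite (fr3.1 Vviol).
    have AS3 : arrs s3 AS =1 arrs s1 AS by move=> q; rewrite (fr3.2 AS).
    split.
      by case: (violated st); rewrite ?orbT ?orbF /= ?viol3.
    have AS4 (r : 'I_m) : (r < k'.+1)%N -> arrs s4 AS r = code (state_of M y F r).
      rewrite /s4 /= ltnS leq_eqVlt => /orP[/eqP rk|rk].
        by rewrite rk eqxx (_ : r = k') //; apply: val_inj.
      by rewrite ltn_eqF // AS3 s1S.
    by case: (violated st).
- by move=> s' [].
Qed.

Lemma runs_add_agent s F :
  holds_input M y s -> represents s F -> states_ready s F -> F != setT ->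
  runs add_agent s (150 * (m * n)) (fun s' =>
    [/\ frame add_agent s s', vars s' Vsize = vars s Vsize + 1
      & exists2 j, is_argmax L G F j & represents s' (j |: F)]).
Proof.
move=> inp sF sS FT; have [sm sn sM sY] := inp.
(* Either no agent outside F has been met and [Vbest] still holds the sentinel -1, or [Varg] holds a
   maximizer among those met. The sentinel is below every score, so the first agent outside F is
   always taken. *)
pose I i s' :=
  (vars s' Vbest = -1 /\ forall j : 'I_n, (j < i)%N -> j \in F) \/
  exists a : 'I_n, [/\ a \notin F, vars s' Varg = a,
    vars s' Vbest = score L G F a
    & forall j : 'I_n, (j < i)%N -> j \notin F -> (score L G F j <= score L G F a)%N].
suff H : runs add_agent s (150 * (m * n)) (fun s' =>
    vars s' Vsize = vars s Vsize + 1 /\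
    exists2 j, is_argmax L G F j & represents s' (j |: F)).
  by apply: (runs_weaken (runs_frame H)) (leqnn _) => s' [fr []].
apply: (@runs_seq _ _ _ 2 (n * (67 * m + 9) + 20)); last nia.
apply: runs_loop_free => //=.
set s0 := set_var _ _ _.
apply: (@runs_seq _ _ _ (n * (67 * m + 9) + 7) 8); last lia.
apply: (runs_weaken (@runs_for Vj Vn _ n (67 * m) I s0 _ _ _ _ _ _) _ (leqnn _)) => //=.
- by left.
- move=> j s1 jn fr s1j Ij.
  pose j' := Ordinal jn; have jE : j = j' by [].
  have {}inp : holds_input M y s1.
    by apply: (holds_input_frame _ fr) => //; case: inp.
  have {}sF : represents s1 F by exact: (represents_frame _ fr).
  have {}sS : states_ready s1 F by move=> k; rewrite (fr.2 AS) //= sS.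
  case: inp => {}sm {}sn {}sM {}sY.
  apply: (@runs_if _ _ _ _ (27 * m + 35)) => /=; last lia.
  rewrite s1j (sF j'); case: (boolP (j' \in F)) => jF /=.
    apply: runs_loop_free => //=; last lia.
    case: Ij => [[b h]|[a [aF arg b h]]]; [left|right; exists a]; split=> // i;
      rewrite ltnS leq_eqVlt => /orP[/eqP ij|ij].
    + by rewrite (_ : i = j') //; apply: val_inj.
    + exact: h.
    + by rewrite (_ : i = j') ?jF //; apply: val_inj.
    + exact: h.
  apply: (@runs_seq _ _ _ 2 (27 * m + 32)) => //=; last lia.
  apply: runs_loop_free => //=.
  set s2 := set_var _ _ _.
  apply: (@runs_seq _ _ _ (m * (18 + 9) + 7) 24); last lia.
  pose J k s' := vars s' Vcnt = \sum_(r < m | (r < k)%N)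
    (if critical (state_of M y F r)
     then (j' \in matching_set (L r) G)%:R else 0).
  apply: (runs_weaken (@runs_for Vk Vm _ m 18 J s2 _ _ _ _ _ _) _ (leqnn _)) => //=.
  + by rewrite /J big_pred0.
  + move=> k s3 km fr3 s3k Jk; pose k' := Ordinal km; have kE : k = k' by [].
    apply: runs_loop_free => //=.
    rewrite s3k (fr3.1 Vj) //= (fr3.1 Vn) //= (fr3.2 AM) //= (fr3.2 AS) //=.
    rewrite s1j sn -PoszM -PoszD !absz_nat (sM k' j') (sS k').
    rewrite /J kE sum_ltS mxE.
    (* Only the code of [Consistent] is skipped, so the rows counted are the critical ones; a matrix
       entry equals 1 exactly when the agent is in the matching set. *)
    case: (state_of M y F k') => /=; rewrite ?addr0 //;
      by case: (j' \in matching_set _ _) => /=; rewrite Jk ?addr0.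
  + move=> s3 [fr3]; rewrite /J => Jm.
    have cE : vars s3 Vcnt = score L G F j'.
      rewrite Jm /score -natz natr_sum [RHS]big_mkcond [LHS]big_mkcond.
      by apply: eq_bigr => r _; rewrite ltn_ord.
    have best3 : vars s3 Vbest = vars s1 Vbest by rewrite (fr3.1 Vbest).
    have arg3 : vars s3 Varg = vars s1 Varg by rewrite (fr3.1 Varg).
    have j3 : vars s3 Vj = j' by rewrite (fr3.1 Vj).
    have I_next (a : 'I_n) s4 : a \notin F -> vars s4 Varg = a ->
        vars s4 Vbest = score L G F a -> (score L G F j' <= score L G F a)%N ->
        (forall i : 'I_n, (i < j)%N -> i \notin F ->
           (score L G F i <= score L G F a)%N) ->
        I j.+1 s4.
      move=> aF arg4 b4 le h; right; exists a; split=> // i.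
      rewrite ltnS leq_eqVlt => /orP[/eqP ij _|]; last exact: h.
      by rewrite (_ : i = j') //; apply: val_inj.
    apply: runs_loop_free => //=.
    rewrite j3 best3 cE; case: Ij => [[b h]|[a [aF arg b h]]].
      by rewrite b /=; apply: (I_next j') => //= i /h ->.
    rewrite b ltz_nat eqz_nat; case: ltngtP => /= [lt|lt|eq].
    * by apply: (I_next j') => //= i ij iF; exact: leq_trans (h _ ij iF) (ltnW lt).
    * by apply: (I_next a) => //=; rewrite ?arg3 ?best3 // ltnW.
    (* On a tie the two scores agree, so either outcome of the coin leaves a maximizer in [Varg]. *)
    * case: (coins s3 0) => /=.
        by apply: (I_next j') => //=; rewrite ?best3 ?b ?eq // => i ij iF; rewrite -eq h.
      by apply: (I_next a) => //=; rewrite ?arg3 ?best3 // eq.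
- move=> s1 [fr [[_ h]|[a [aF arg b h]]]].
    (* The sentinel cannot survive the scan: every agent would then lie in F, against F being
       proper. *)
    by case/eqP: FT; apply/setP => j; rewrite inE h.
  apply: runs_loop_free => //=; split; first by rewrite (fr.1 Vsize).
  exists a; first by rewrite /is_argmax aF; apply/forallP => j; apply/implyP/h.
  move=> j /=; rewrite arg absz_nat (fr.2 AF) //= sF !inE.
  by rewrite -val_eqE; case: eqP.
Qed.

(** The row sum is the signed count defining [fplus], with its sign reversed when the prediction is
    False. Hence a row is violated exactly when F and the oracle disagree on it, the tie being
    resolved by the prediction, and [compute_states] decides feasibility. *)
Lemma feasibleE F : feasible L G F = ~~ has_violation L G F.
Proof.
rewrite /feasible /has_violation negb_exists; apply: eq_forallb => k.
set S := \sum_(j in F) ((L k j == false)%:R - (L k j == true)%:R : int).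
have sumE : rowsum (matching_mx L G) F k = if oracle L G k then S else - S.
  rewrite /rowsum /S /oracle; case: ifP => Gk; rewrite -?sumrN;
    apply: eq_bigr => j _; rewrite mxE /matching_set Gk inE;
    by case: (L k j).
rewrite /state_of sumE /fplus -/S /oracle /fplus.
case: (0 < \sum_(j in G) _); case: (ltgtP S 0) => S0 /=;
  rewrite ?oppr_lt0 ?oppr_eq0 ?S0 ?oppr0 ?ltxx ?eqxx ?(lt_gtF S0) ?(lt_eqF S0)
          ?(gt_eqF S0) //; by case: (_ == 1).
Qed.

(** Sharper than [output]: failure means that [Vfound] is exactly 0, the value tested by the
    loops. *)
Definition finished (s : state) (out : option {set 'I_n}) : Prop :=
  if out is Some F then vars s Vfound = 1 /\ represents s F
  else vars s Vfound = 0.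

Lemma finished_output s out : finished s out -> output n s = out.
Proof.
case: out => [F|] /=; rewrite /output; last by move=> ->.
case=> -> sF /=; congr Some; apply/setP => j.
by rewrite inE sF; case: (j \in F).
Qed.

Lemma runs_fill (c : int) (F : {set 'I_n}) s :
  vars s Vn = n -> (forall j : 'I_n, c = (j \in F)%:R) ->
  runs (For Vj Vn (Store AF Vj (Cst c))) s (12 * n + 7)
    (fun s' => frame (For Vj Vn (Store AF Vj (Cst c))) s s' /\ represents s' F).
Proof.
move=> sn cF.
pose I i s' := forall j : 'I_n, (j < i)%N -> arrs s' AF j = (j \in F)%:R.
apply: (runs_weaken (@runs_for Vj Vn _ n 3 I s _ _ _ _ _ _)) => //=; last lia.
- move=> i s1 iN fr s1j Ii; apply: runs_loop_free => //= j.
  rewrite s1j absz_nat ltnS leq_eqVlt /= => /orP[/eqP ->|ji].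
    by rewrite eqxx -cF.
  by rewrite ltn_eqF // Ii.
- by move=> s' [fr In]; split=> // j; exact: In.
Qed.

(** * The growth loop, the loop over seeds, and the total time *)

Definition grow_loop : stmt :=
  (While ((Vsize <? Vn) && (Vfound =? Cst 0))
     (compute_states ;;
      If (Vviol =? Cst 0) (Vfound ::= Cst 1) add_agent))%stmt.

(** Induction on the number [d] of agents outside F, which drops at each round because the chosen
    agent is new. A round costs two blocks of [150 * (m * n)] and a constant absorbed by the
    remaining [20 * (m * n)]; the final 8 pays the last test. The agent picked by the coins provides
    the [grow_add] step. *)
Lemma runs_grow_loop d s (F : {set 'I_n}) : (d + #|F|)%N = n ->
  holds_input M y s -> represents s F -> vars s Vsize = #|F| ->
  vars s Vfound = 0 ->
  runs grow_loop s (d * (320 * (m * n)) + 8)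
    (fun s' => exists2 out, grow L G F out & finished s' out).
Proof.
have mn_gt0 : (0 < m * n)%N by rewrite muln_gt0 m_gt0.
elim: d s F => [|d IHd] s F dF inp sF size_s found_s; have [sm sn sM sY] := inp.
  have FT : F = setT.
    by apply/eqP; rewrite eqEcard subsetT cardsT card_ord; lia.
  apply: runs_while_stop => //=.
    by rewrite size_s sn ltz_nat (_ : (#|F| < n)%N = false) //; lia.
  by exists None => //; rewrite FT; exact: grow_full.
have FT : F != setT.
  by apply: contraPneq dF => ->; rewrite cardsT card_ord; lia.
apply: (@runs_while_step _ _ _ (300 * (m * n) + 6) (d * (320 * (m * n)) + 8)) => /=; last nia.
  by rewrite size_s sn found_s ltz_nat (_ : (#|F| < n)%N) //; lia.
apply: (@runs_seq _ _ _ (150 * (m * n)) (150 * (m * n) + 5)); last lia.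
apply: (runs_weaken (runs_compute_states inp sF)) (leqnn _) => s1 [fr1 viol1 S1].
have inp1 : holds_input M y s1 by exact: (holds_input_frame _ fr1).
have sF1 : represents s1 F by exact: (represents_frame _ fr1).
have found1 : vars s1 Vfound = 0 by rewrite (fr1.1 Vfound).
have size1 : vars s1 Vsize = #|F| by rewrite (fr1.1 Vsize).
apply: (@runs_if _ _ _ _ (150 * (m * n))) => /=; last lia.
rewrite viol1; case: (boolP (has_violation L G F)) => viol /=.
  apply: (runs_weaken (runs_add_agent inp1 sF1 S1 FT)) (leqnn _).
  move=> s2 [fr2 size2 [j jmax sF2]].
  have jF : j \notin F by case/andP: jmax.
  apply: (runs_weaken (IHd s2 (j |: F) _ _ _ _ _)) => //.
  - by rewrite cardsU1 jF; lia.
  - exact: (holds_input_frame _ fr2).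
  - by rewrite size2 size1 cardsU1 jF addrC.
  - by rewrite (fr2.1 Vfound).
  - by move=> s' [out g fin]; exists out => //; exact: grow_add jmax g.
apply: runs_loop_free => //=; last lia.
(* With [Vfound] set to 1 the loop test fails at once, which realizes the return of F. *)
apply: runs_while_stop => //=; last lia.
  by rewrite andbF.
by exists (Some F) => //; exact: grow_return.
Qed.

Definition seeds_loop : stmt :=
  (While ((Vs <? Vn) && (Vfound =? Cst 0))
     (For Vj Vn (Store AF Vj (Cst 0)) ;;
      Store AF Vs (Cst 1) ;;
      Vsize ::= Cst 1 ;;
      grow_loop ;;
      Vs ::= Vs + Cst 1))%stmt.

(** Induction on the number [d] of seeds left; since [enum] lists the agents in increasing order,
    those seeds are the suffix of the enumeration from the counter on. *)
Lemma runs_seeds_loop d i s : (d + i)%N = n ->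
  holds_input M y s -> vars s Vs = i -> vars s Vfound = 0 ->
  runs seeds_loop s (d * (400 * (m * n ^ 2)) + 8) (fun s' => holds_input M y s' /\
    exists2 out, try_seeds L G (drop i (enum 'I_n)) out & finished s' out).
Proof.
have mn_gt0 : (0 < m * n)%N by rewrite muln_gt0 m_gt0.
move=> di inp si found_s.
suff H : runs seeds_loop s (d * (400 * (m * n ^ 2)) + 8) (fun s' =>
    exists2 out, try_seeds L G (drop i (enum 'I_n)) out & finished s' out).
  apply: (runs_weaken (runs_frame H)) (leqnn _) => s' [fr fin]; split=> //.
  exact: (holds_input_frame _ fr).
elim: d i s di inp si found_s => [|d IHd] i s di inp si found_s;
  have [sm sn sM sY] := inp.
  apply: runs_while_stop => //=.
    by rewrite si sn -di add0n ltxx.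
  exists None => //; rewrite drop_oversize ?size_enum_ord -?di //.
  exact: seeds_nil.
have iN : (i < n)%N by lia.
pose i' := Ordinal iN.
have dropE : drop i (enum 'I_n) = i' :: drop i.+1 (enum 'I_n).
  by rewrite (drop_nth i') ?size_enum_ord // (nth_ord_enum i' i').
rewrite dropE.
set T := (400 * (m * n ^ 2))%N.
have T_ge : (320 * (m * n) * n.-1 + 320 * (m * n) <= 320 * (m * n ^ 2))%N by nia.
have T_ge' : (n <= m * n ^ 2)%N by nia.
apply: (@runs_while_step _ _ _ (T - 8) (d * T + 8)) => /=; last lia.
  by rewrite si sn found_s ltz_nat iN.
(* A seed set has one element, leaving [n.-1] agents to add. Growth thus stays within about
   [320 * (m * n ^ 2)], and the rest of [T] covers the reset of F and the constants. *)
pose Tg := (n.-1 * (320 * (m * n)) + 8)%N.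
apply: (@runs_seq _ _ _ (12 * n + 7) (Tg + 18)); last by rewrite /Tg /T; nia.
apply: (runs_weaken (@runs_fill 0 set0 s sn _)) (leqnn _).
  by move=> j; rewrite inE.
move=> s1 [fr1 sF1].
apply: (@runs_seq _ _ _ 3 (Tg + 14)); last lia.
apply: runs_loop_free => //=.
apply: (@runs_seq _ _ _ 2 (Tg + 11)); last lia.
apply: runs_loop_free => //=.
set s2 := set_var _ _ _.
apply: (@runs_seq _ _ _ Tg 10); last lia.
have found2 : vars s2 Vfound = 0 by rewrite /= (fr1.1 Vfound).
have s1i : vars s1 Vs = i by rewrite (fr1.1 Vs).
have inp2 : holds_input M y s2.
  have inp1 : holds_input M y s1 by exact: (holds_input_frame _ fr1).
  by case: inp1 => a b c e; split.
(* Writing 1 at the position held in [Vs] turns the zero vector into the characteristic vector of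
   the seed. *)
have sF2 : represents s2 [set i'].
  move=> j; rewrite /= s1i absz_nat inE -val_eqE /=.
  by case: eqP => // _; rewrite sF1 inE.
have H : runs grow_loop s2 Tg
    (fun s' => exists2 out, grow L G [set i'] out & finished s' out).
  by apply: runs_grow_loop => //=; rewrite cards1; lia.
apply: (runs_weaken (runs_frame H)) (leqnn _) => s3 [fr3 [out g fin]].
apply: runs_loop_free => //=.
have s3i : vars s3 Vs = i by rewrite (fr3.1 Vs).
have inp3 : holds_input M y s3 by exact: (holds_input_frame _ fr3).
case: out g fin => [F|] g fin.
  apply: runs_while_stop => //=; last lia.
    by rewrite fin.1 andbF.
  by exists (Some F) => //; exact: seeds_return.
apply: (runs_weaken (IHd i.+1 _ _ _ _ _)) => //=.
- lia.
- by rewrite s3i -addn1 PoszD.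
- by move=> s4 [out ts fin4]; exists out => //; exact: seeds_next.
Qed.

Lemma runs_waterfall_prog s : holds_input M y s ->
  runs waterfall_prog s (1000 * (m * n ^ 3))
    (fun s' => waterfall L G (output n s')).
Proof.
have mn_gt0 : (0 < m * n)%N by rewrite muln_gt0 m_gt0.
move=> inp.
have T1 : (n * (m * n ^ 2) = m * n ^ 3)%N by rewrite mulnCA -expnS.
have T2 : (m * n <= m * n ^ 3)%N by rewrite leq_mul2l -{1}(expn1 n) leq_pexp2l ?orbT.
have T3 : (n <= m * n)%N by rewrite leq_pmull.
have fin_w s' out : waterfall L G out -> finished s' out -> waterfall L G (output n s').
  by move=> w /finished_output ->.
(* With [B] as unit, the seeds take 400 up to a constant, each of the two feasibility tests at most
   150, and the refills of F and the constants fit in what remains of 1000. *)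
set B := (m * n ^ 3)%N in T1 T2 *.
apply: (@runs_seq _ _ _ 2 (990 * B)); last lia.
apply: runs_loop_free => //=.
set s0 := set_var _ _ _.
have {}inp : holds_input M y s0 by case: inp => a b c e; split.
have n0 : vars s0 Vn = n by case: inp.
apply: (@runs_seq _ _ _ (12 * n + 7) (960 * B)); last lia.
apply: (runs_weaken (@runs_fill 0 set0 s0 n0 _)) (leqnn _).
  by move=> j; rewrite inE.
move=> s1 [fr1 sF1].
have inp1 : holds_input M y s1 by exact: (holds_input_frame _ fr1).
apply: (@runs_seq _ _ _ (150 * (m * n)) (800 * B)); last lia.
apply: (runs_weaken (runs_compute_states inp1 sF1)) (leqnn _) => s2 [fr2 viol2 _].
have inp2 : holds_input M y s2 by exact: (holds_input_frame _ fr2).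
have sF2 : represents s2 set0 by exact: (represents_frame _ fr2).
apply: (@runs_if _ _ _ _ (790 * B)) => /=; last lia.
rewrite viol2; case: (boolP (has_violation L G set0)) => viol0 /=; last first.
  apply: runs_loop_free => //=; last lia.
  apply: (@fin_w _ (Some set0)); last by split.
  by apply: waterfall_empty; rewrite feasibleE.
have infeas0 : ~~ feasible L G set0 by rewrite feasibleE viol0.
apply: (@runs_seq _ _ _ 2 (780 * B)); last lia.
apply: runs_loop_free => //=.
set s3 := set_var _ _ _.
have inp3 : holds_input M y s3 by case: inp2 => a b c e; split.
have found3 : vars s3 Vfound = 0 by rewrite /= (fr2.1 Vfound) // (fr1.1 Vfound).
apply: (@runs_seq _ _ _ (n * (400 * (m * n ^ 2)) + 8) (300 * B)); last lia.
apply: (runs_weaken (@runs_seeds_loop n 0 s3 _ inp3 _ found3)) (leqnn _) => //.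
  by rewrite addn0.
move=> s4 [inp4 [out]]; rewrite drop0 => ts fin.
apply: (@runs_if _ _ _ _ (290 * B)) => /=; last lia.
case: out ts fin => [F|] ts fin.
  rewrite fin.1 /=; apply: runs_loop_free => //=; last lia.
  by apply: fin_w fin; exact: waterfall_seed.
rewrite fin /=.
have n4 : vars s4 Vn = n by case: inp4.
apply: (@runs_seq _ _ _ (12 * n + 7) (240 * B)); last lia.
apply: (runs_weaken (@runs_fill 1 setT s4 n4 _)) (leqnn _).
  by move=> j; rewrite inE.
move=> s5 [fr5 sF5].
have inp5 : holds_input M y s5 by exact: (holds_input_frame _ fr5).
apply: (@runs_seq _ _ _ (150 * (m * n)) (20 * B)); last lia.
apply: (runs_weaken (runs_compute_states inp5 sF5)) (leqnn _) => s6 [fr6 viol6 _].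
have sF6 : represents s6 setT by exact: (represents_frame _ fr6).
have found6 : vars s6 Vfound = 0 by rewrite (fr6.1 Vfound) // (fr5.1 Vfound).
apply: runs_loop_free => //=; last lia.
rewrite viol6; case: (boolP (has_violation L G setT)) => violT /=.
  apply: (@fin_w _ None) => //.
  by apply: waterfall_fail; rewrite // feasibleE violT.
apply: (@fin_w _ (Some setT)); last by split.
by apply: waterfall_all; rewrite // feasibleE.
Qed.

End Waterfall_run.

End Execution.

(** The coins belong to the arbitrary initial state and [exec_det] makes the run unique, so the
    bound covers every outcome of the flips. *)
Theorem proposition7 :
  exists C : nat,
    forall (m n : nat) (L : 'I_m -> labelling n) (G : {set 'I_n}) (s : state),
      0 < m -> 0 < n ->
      holds_input (matching_mx L G) (oracle L G) s ->
      exists (t : nat) (s' : state),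
        [/\ exec waterfall_prog s t s',
            waterfall L G (output n s')
          & t <= C * (m * n ^ 3)].
Proof. by exists 1000 => m n L G s m0 n0; exact: runs_waterfall_prog. Qed.
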